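(* Let $\mathcal{X}$ and $\mathcal{C}$ be left autonomous monoidal categories. Let there be a strong action of $\mathcal{X}$ on $\mathcal{C}$. Then the semidirect product $\mathcal{X} \ltimes \mathcal{C}$ is a left autonomous monoidal category.
   Context: In a monoidal category the structure isomorphisms are directed as $\alpha_{A,B,C} \colon A \otimes (B \otimes C) \to (A \otimes B) \otimes C$, $\lambda_A \colon A \to \mathcal{I} \otimes A$, $\rho_A \colon A \otimes \mathcal{I} \to A$. An object's name also denotes its identity morphism. A left dual of an object $A$ of a monoidal category is an object ${}^\vee A$ together with evaluation and coevaluation morphisms $\varepsilon^A \colon {}^\vee A \otimes A \to \mathcal{I}$ and $\eta^A \colon \mathcal{I} \to A \otimes {}^\vee A$ satisfying the usual triangle (zig-zag) identities. A monoidal category is left autonomous if every object has a left dual. Strong action of $\mathcal{X}$ on $\mathcal{C}$: a strong monoidal functor $\Gamma$ from $\mathcal{X}$ to $[\mathcal{C},\mathcal{C}]$, the strict monoidal category of strong monoidal endofunctors of $\mathcal{C}$ and monoidal natural transformations, with tensor product given by functor composition in diagrammatic order. For an object $X$ (morphism $f$) of $\mathcal{X}$, write $(-)^X$ (respectively $(-)^f$) for $\Gamma(X)$ (respectively $\Gamma(f)$). The structure isomorphisms of the strong monoidal functor $(-)^X$ are $\varphi^X_{B,C} \colon B^X \otimes C^X \to (B \otimes C)^X$ and $\varphi^X \colon \mathcal{I}_{\mathcal{C}} \to \mathcal{I}_{\mathcal{C}}^X$. The structure isomorphisms of $\Gamma$, in the oplax direction, are monoidal natural isomorphisms with components $\psi^{X,Y}_C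 \colon C^{X \otimes Y} \to (C^X)^Y$ and $\psi_C \colon C^{\mathcal{I}_{\mathcal{X}}} \to C$. Semidirect product $\mathcal{X} \ltimes \mathcal{C}$ (a monoidal category): the underlying category is $\mathcal{X} \times \mathcal{C}$, with objects written $\langle X, C \rangle$. The tensor product is $\langle X, B \rangle \otimes \langle Y, C \rangle = \langle X \otimes Y, B^Y \otimes C \rangle$ (and correspondingly on morphisms) and the unit is $\langle \mathcal{I}_{\mathcal{X}}, \mathcal{I}_{\mathcal{C}} \rangle$. The structure maps are given by their components in $\mathcal{X}$ and in $\mathcal{C}$. Their $\mathcal{X}$-components are the structure maps $\alpha_{X,Y,Z}$, $\lambda_X$, $\rho_X$ of $\mathcal{X}$. Their $\mathcal{C}$-components are: for $\alpha_{\langle X,A \rangle, \langle Y,B \rangle, \langle Z,C \rangle}$, the composite $(\varphi^Z_{A^Y,B} \otimes C) \circ \alpha_{(A^Y)^Z,B^Z,C} \circ (\psi^{Y,Z}_A \otimes (B^Z \otimes C)) \colon A^{Y \otimes Z} \otimes (B^Z \otimes C) \to (A^Y \otimes B)^Z \otimes C$; for $\lambda_{\langle X,C \rangle}$, the composite $(\varphi^X \otimes C) \circ \lambda_C \colon C \to \mathcal{I}_{\mathcal{C}}^X \otimes C$; for $\rho_{\langle X,C \rangle}$, the composite $\rho_C \circ (\psi_C \otimes \mathcal{I}_{\mathcal{C}}) \colon C^{\mathcal{I}_{\mathcal{X}}} \otimes \mathcal{I}_{\mathcal{C}} \to C$. *)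

(* Defs.v *)
From Stdlib Require Import ssreflect FunctionalExtensionality ProofIrrelevance.

Set Implicit Arguments.
Unset Strict Implicit.
Unset Printing Implicit Defensive.

Declare Scope cat_scope.
Delimit Scope cat_scope with cat.
Open Scope cat_scope.

Reserved Notation "g ∘ f" (at level 40, left associativity).
Reserved Notation "A ⊗ B" (at level 38, left associativity).
Reserved Notation "f ⊗m g" (at level 38, left associativity).

Record category : Type := Category {
  ob :> Type;
  hom : ob -> ob -> Type;
  idm : forall a, hom a a;
  comp : forall a b c, hom b c -> hom a b -> hom a c;
  comp1m : forall a b (f : hom a b), comp (idm b) f = f;
  compm1 : forall a b (f : hom a b), comp f (idm a) = f;
  compA : forall a b c d (h : hom c d) (g : hom b c) (f : hom a b),
    comp h (comp g f) = comp (comp h g) f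
}.
Arguments hom {_} _ _.
Arguments idm {_} _.
Arguments comp {_ _ _ _} _ _.
Notation "g ∘ f" := (comp g f) : cat_scope.

Lemma comp_cut (C : category) (a b b' c : C) (g : hom b c) (f : hom a b)
  (g' : hom b' c) (f' : hom a b') :
  g ∘ f = g' ∘ f' -> forall d (k : hom d a), g ∘ (f ∘ k) = g' ∘ (f' ∘ k).
Proof. by move=> e d k; rewrite !compA e. Qed.

Record iso (C : category) (a b : C) : Type := Iso {
  iso_hom :> hom a b;
  iso_inv : hom b a;
  isoK : iso_inv ∘ iso_hom = idm a;
  isoVK : iso_hom ∘ iso_inv = idm b
}.
Arguments iso {C} a b.

Definition iso_sym (C : category) (a b : C) (i : iso a b) : iso b a :=
  Iso (isoVK i) (isoK i).

Definition iso_comp (C : category) (a b c : C) (j : iso b c) (i : iso a b) :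
  iso a c.
Proof.
refine (@Iso C a c (j ∘ i) (iso_inv i ∘ iso_inv j) _ _).
- abstract (by rewrite compA -(compA (iso_inv i)) isoK compm1 isoK).
- abstract (by rewrite compA -(compA (iso_hom j)) isoVK compm1 isoVK).
Defined.

Definition iso_id (C : category) (a : C) : iso a a :=
  Iso (comp1m (idm a)) (comp1m (idm a)).

Record functor (C D : category) : Type := Functor {
  fob :> C -> D;
  fmap : forall a b, hom a b -> hom (fob a) (fob b);
  fmap1 : forall a, fmap (idm a) = idm (fob a);
  fmapM : forall a b c (g : hom b c) (f : hom a b),
    fmap (g ∘ f) = fmap g ∘ fmap f
}.
Arguments fmap {C D} _ {a b} _.

Definition iso_fmap (C D : category) (F : functor C D) (a b : C)
  (i : iso a b) : iso (F a) (F b).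
Proof.
refine (@Iso D (F a) (F b) (fmap F i) (fmap F (iso_inv i)) _ _).
- abstract (by rewrite -fmapM isoK fmap1).
- abstract (by rewrite -fmapM isoVK fmap1).
Defined.

Definition id_functor (C : category) : functor C C :=
  @Functor C C (fun a => a) (fun _ _ f => f)
    (fun _ => eq_refl) (fun _ _ _ _ _ => eq_refl).

Definition comp_functor (C D E : category) (G : functor D E)
  (F : functor C D) : functor C E.
Proof.
refine (@Functor C E (fun a => G (F a)) (fun _ _ f => fmap G (fmap F f)) _ _).
- abstract (by move=> a; rewrite !fmap1).
- abstract (by move=> a b c g f; rewrite !fmapM).
Defined.

Definition prod_category (C D : category) : category.
Proof.
refine (@Category (C * D)%type
  (fun p q => (hom (fst p) (fst q) * hom (snd p) (snd q))%type)
  (fun p => (idm (fst p), idm (snd p)))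
  (fun _ _ _ g f => (fst g ∘ fst f, snd g ∘ snd f)) _ _ _).
- abstract (by move=> a b [f g] /=; rewrite !comp1m).
- abstract (by move=> a b [f g] /=; rewrite !compm1).
- abstract (by move=> a b c d [h h'] [g g'] [f f'] /=; rewrite !compA).
Defined.

Definition iso_pair (C D : category) (p q : prod_category C D)
  (i : iso (fst p) (fst q)) (j : iso (snd p) (snd q)) : iso p q.
Proof.
refine (@Iso (prod_category C D) p q (iso_hom i, iso_hom j)
  (iso_inv i, iso_inv j) _ _).
- abstract (by rewrite /= !isoK).
- abstract (by rewrite /= !isoVK).
Defined.

(** A category with a bifunctor, a unit and families of isomorphisms that are
    not yet required to be natural or coherent. *)
Record monoidal_data : Type := MonoidalData {
  mcat :> category;
  unit : mcat;
  tens : mcat -> mcat -> mcat;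
  tensm : forall a a' b b' : mcat,
    hom a a' -> hom b b' -> hom (tens a b) (tens a' b');
  tensm1 : forall a b, tensm (idm a) (idm b) = idm (tens a b);
  tensmM : forall a a' a'' b b' b'' (f' : hom a' a'') (f : hom a a')
    (g' : hom b' b'') (g : hom b b'),
    tensm (f' ∘ f) (g' ∘ g) = tensm f' g' ∘ tensm f g;
  assoc : forall a b c, iso (tens a (tens b c)) (tens (tens a b) c);
  lunit : forall a, iso a (tens unit a);
  runit : forall a, iso (tens a unit) a
}.
Arguments unit {m}.
Arguments tens {m} _ _.
Arguments tensm {m a a' b b'} _ _.
Arguments assoc {m} a b c.
Arguments lunit {m} a.
Arguments runit {m} a.
Notation "A ⊗ B" := (tens A B) : cat_scope.
Notation "f ⊗m g" := (tensm f g) : cat_scope.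

Record monoidal_axioms (M : monoidal_data) : Prop := MonoidalAxioms {
  assoc_nat : forall (a a' b b' c c' : M)
    (f : hom a a') (g : hom b b') (h : hom c c'),
    ((f ⊗m g) ⊗m h) ∘ assoc a b c = assoc a' b' c' ∘ (f ⊗m (g ⊗m h));
  lunit_nat : forall (a a' : M) (f : hom a a'),
    (idm unit ⊗m f) ∘ lunit a = lunit a' ∘ f;
  runit_nat : forall (a a' : M) (f : hom a a'),
    f ∘ runit a = runit a' ∘ (f ⊗m idm unit);
  pentagon : forall a b c d : M,
    (assoc a b c ⊗m idm d) ∘ assoc a (b ⊗ c) d ∘ (idm a ⊗m assoc b c d)
    = assoc (a ⊗ b) c d ∘ assoc a b (c ⊗ d);
  triangle : forall a b : M,
    (runit a ⊗m idm b) ∘ assoc a unit b ∘ (idm a ⊗m lunit b) = idm (a ⊗ b)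
}.

Record monoidal_category : Type := MonoidalCategory {
  mdata :> monoidal_data;
  maxioms : monoidal_axioms mdata
}.

Record left_dual (M : monoidal_data) (a : M) : Type := LeftDual {
  dual_ob : M;
  ev : hom (dual_ob ⊗ a) unit;
  coev : hom unit (a ⊗ dual_ob);
  zigzag : runit a ∘ (idm a ⊗m ev) ∘ iso_inv (assoc a dual_ob a)
    ∘ (coev ⊗m idm a) ∘ lunit a = idm a;
  zigzag_dual : iso_inv (lunit dual_ob) ∘ (ev ⊗m idm dual_ob)
    ∘ assoc dual_ob a dual_ob ∘ (idm dual_ob ⊗m coev)
    ∘ iso_inv (runit dual_ob) = idm dual_ob
}.
Arguments left_dual {M} a.

Definition left_autonomous (M : monoidal_data) : Prop :=
  forall a : M, inhabited (left_dual a).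

Definition iso_tens (M : monoidal_data) (a a' b b' : M)
  (i : iso a a') (j : iso b b') : iso (a ⊗ b) (a' ⊗ b').
Proof.
refine (@Iso M (a ⊗ b) (a' ⊗ b') (i ⊗m j) (iso_inv i ⊗m iso_inv j) _ _).
- abstract (by rewrite -tensmM !isoK tensm1).
- abstract (by rewrite -tensmM !isoVK tensm1).
Defined.

Lemma tensm_compl (M : monoidal_data) (a a' a'' b : M) (f' : hom a' a'')
  (f : hom a a') : (f' ∘ f) ⊗m idm b = (f' ⊗m idm b) ∘ (f ⊗m idm b).
Proof. by rewrite -tensmM comp1m. Qed.

Lemma tensm_compr (M : monoidal_data) (a b b' b'' : M) (g' : hom b' b'')
  (g : hom b b') : idm a ⊗m (g' ∘ g) = (idm a ⊗m g') ∘ (idm a ⊗m g).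
Proof. by rewrite -tensmM comp1m. Qed.

Record strong_functor (M N : monoidal_category) : Type := StrongFunctor {
  sfun :> functor M N;
  phi : forall a b, iso (sfun a ⊗ sfun b) (sfun (a ⊗ b));
  phi0 : iso unit (sfun unit);
  phi_nat : forall (a a' b b' : M) (f : hom a a') (g : hom b b'),
    fmap sfun (f ⊗m g) ∘ phi a b = phi a' b' ∘ (fmap sfun f ⊗m fmap sfun g);
  phi_assoc : forall a b c : M,
    fmap sfun (assoc a b c) ∘ phi a (b ⊗ c) ∘ (idm (sfun a) ⊗m phi b c)
    = phi (a ⊗ b) c ∘ (phi a b ⊗m idm (sfun c))
      ∘ assoc (sfun a) (sfun b) (sfun c);
  phi_lunit : forall a : M,
    fmap sfun (lunit a)
    = phi unit a ∘ (phi0 ⊗m idm (sfun a)) ∘ lunit (sfun a);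
  phi_runit : forall a : M,
    fmap sfun (runit a) ∘ phi a unit ∘ (idm (sfun a) ⊗m phi0)
    = runit (sfun a)
}.
Arguments phi {M N} s a b.
Arguments phi0 {M N} s.

Lemma phi_natl (M N : monoidal_category) (F : strong_functor M N)
  (a a' b : M) (f : hom a a') :
  fmap F (f ⊗m idm b) ∘ phi F a b = phi F a' b ∘ (fmap F f ⊗m idm (F b)).
Proof. by rewrite phi_nat fmap1. Qed.

Lemma phi_natr (M N : monoidal_category) (F : strong_functor M N)
  (a b b' : M) (g : hom b b') :
  fmap F (idm a ⊗m g) ∘ phi F a b = phi F a b' ∘ (idm (F a) ⊗m fmap F g).
Proof. by rewrite phi_nat fmap1. Qed.

Record mon_trans (M N : monoidal_category) (F G : strong_functor M N) : Type :=
  MonTrans {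
  mt :> forall a : M, hom (F a) (G a);
  mt_nat : forall (a b : M) (f : hom a b), mt b ∘ fmap F f = fmap G f ∘ mt a;
  mt_phi : forall a b : M, mt (a ⊗ b) ∘ phi F a b = phi G a b ∘ (mt a ⊗m mt b);
  mt_phi0 : mt unit ∘ phi0 F = phi0 G
}.

Lemma mon_trans_ext (M N : monoidal_category) (F G : strong_functor M N)
  (s t : mon_trans F G) : (forall a, s a = t a) -> s = t.
Proof.
case: s t => [s p q r] [t p' q' r'] /= e.
have {}e : s = t by apply: functional_extensionality_dep.
case: _ / e p' q' r' => p' q' r'; f_equal; exact: proof_irrelevance.
Qed.

Section Endo.
Variable C : monoidal_category.
Implicit Types F G H : strong_functor C C.

Definition id_trans F : mon_trans F F.
Proof.
refine (@MonTrans C C F F (fun a => idm (F a)) _ _ _).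
- abstract (by move=> a b f; rewrite comp1m compm1).
- abstract (by move=> a b; rewrite tensm1 comp1m compm1).
- abstract (by rewrite comp1m).
Defined.

Definition comp_trans F G H (t : mon_trans G H) (s : mon_trans F G) :
  mon_trans F H.
Proof.
refine (@MonTrans C C F H (fun a => t a ∘ s a) _ _ _).
- abstract (by move=> a b f; rewrite -compA mt_nat !compA mt_nat).
- abstract (by move=> a b; rewrite -compA mt_phi compA mt_phi tensmM compA).
- abstract (by rewrite -compA !mt_phi0).
Defined.

Definition endo_category : category.
Proof.
refine (@Category (strong_functor C C) (@mon_trans C C) id_trans comp_trans
  _ _ _).
- abstract (by move=> F G s; apply: mon_trans_ext => a /=; rewrite comp1m).
- abstract (by move=> F G s; apply: mon_trans_ext => a /=; rewrite compm1).
- abstract (by move=> F G H K u t s; apply: mon_trans_ext => a /=; rewrite compA).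
Defined.

Definition endo_unit : strong_functor C C.
Proof.
refine (@StrongFunctor C C (id_functor C) (fun a b => iso_id (a ⊗ b))
  (iso_id unit) _ _ _ _) => /=.
- abstract (by move=> *; rewrite comp1m compm1).
- abstract (by move=> *; rewrite !tensm1 !compm1 comp1m).
- abstract (by move=> *; rewrite tensm1 !comp1m).
- abstract (by move=> *; rewrite tensm1 !compm1).
Defined.

(** Tensor product of [C, C]: composition in diagrammatic order, [F] first. *)
Definition endo_tens F G : strong_functor C C.
Proof.
refine (@StrongFunctor C C (comp_functor G F)
  (fun a b => iso_comp (iso_fmap G (phi F a b)) (phi G (F a) (F b)))
  (iso_comp (iso_fmap G (phi0 F)) (phi0 G)) _ _ _ _) => /=.
- abstract (by move=> a a' b b' f g;
    rewrite compA -fmapM phi_nat fmapM -!compA phi_nat).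
- abstract (by move=> a b c; rewrite tensm_compr tensm_compl -!compA;
    rewrite -(comp_cut (phi_natr G _ _)) !compA -!fmapM phi_assoc !fmapM -!compA;
    rewrite [fmap G (assoc _ _ _) ∘ _]compA phi_assoc -!compA;
    rewrite (comp_cut (phi_natl G _ _))).
- abstract (by move=> a; rewrite phi_lunit !fmapM phi_lunit tensm_compl -!compA; f_equal;
    rewrite (comp_cut (phi_natl G _ _))).
- abstract (by move=> a; rewrite tensm_compr -!compA -(comp_cut (phi_natr G _ _));
    rewrite !compA -!fmapM phi_runit phi_runit).
Defined.

Definition endo_tensm F F' G G' (s : mon_trans F F') (t : mon_trans G G') :
  mon_trans (endo_tens F G) (endo_tens F' G').
Proof.
refine (@MonTrans C C (endo_tens F G) (endo_tens F' G')
  (fun a => t (F' a) ∘ fmap G (s a)) _ _ _) => /=.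
- abstract (by move=> a b f;
    rewrite -compA -fmapM [s b ∘ _]mt_nat fmapM compA mt_nat compA).
- abstract (by move=> a b; rewrite tensmM -!compA (compA (fmap G _)) -fmapM mt_phi fmapM;
    rewrite -compA (comp_cut (mt_nat t _)); f_equal;
    rewrite phi_nat !compA mt_phi).
- abstract (by rewrite -!compA (compA (fmap G _)) -fmapM mt_phi0;
    rewrite (comp_cut (mt_nat t _)) mt_phi0).
Defined.

Definition endo_assoc F G H :
  @iso endo_category (endo_tens F (endo_tens G H))
    (endo_tens (endo_tens F G) H).
Proof.
unshelve refine (@Iso endo_category (endo_tens F (endo_tens G H))
  (endo_tens (endo_tens F G) H) _ _ _ _).
- refine (@MonTrans C C (endo_tens F (endo_tens G H))
    (endo_tens (endo_tens F G) H) (fun a => idm (H (G (F a)))) _ _ _) => /=.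
  + abstract (by move=> *; rewrite comp1m compm1).
  + abstract (by move=> *; rewrite tensm1 comp1m compm1 fmapM compA).
  + abstract (by rewrite comp1m fmapM compA).
- refine (@MonTrans C C (endo_tens (endo_tens F G) H)
    (endo_tens F (endo_tens G H)) (fun a => idm (H (G (F a)))) _ _ _) => /=.
  + abstract (by move=> *; rewrite comp1m compm1).
  + abstract (by move=> *; rewrite tensm1 comp1m compm1 fmapM compA).
  + abstract (by rewrite comp1m fmapM compA).
- abstract (by apply: mon_trans_ext => a /=; rewrite comp1m).
- abstract (by apply: mon_trans_ext => a /=; rewrite comp1m).
Defined.

Definition endo_lunit F : @iso endo_category F (endo_tens endo_unit F).
Proof.
unshelve refine (@Iso endo_category F (endo_tens endo_unit F) _ _ _ _).
- refine (@MonTrans C C F (endo_tens endo_unit F) (fun a => idm (F a)) _ _ _)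
    => /=.
  + abstract (by move=> *; rewrite comp1m compm1).
  + abstract (by move=> *; rewrite tensm1 fmap1 !comp1m compm1).
  + abstract (by rewrite fmap1).
- refine (@MonTrans C C (endo_tens endo_unit F) F (fun a => idm (F a)) _ _ _)
    => /=.
  + abstract (by move=> *; rewrite comp1m compm1).
  + abstract (by move=> *; rewrite tensm1 fmap1 !comp1m compm1).
  + abstract (by rewrite fmap1 !comp1m).
- abstract (by apply: mon_trans_ext => a /=; rewrite comp1m).
- abstract (by apply: mon_trans_ext => a /=; rewrite comp1m).
Defined.

Definition endo_runit F : @iso endo_category (endo_tens F endo_unit) F.
Proof.
unshelve refine (@Iso endo_category (endo_tens F endo_unit) F _ _ _ _).
- refine (@MonTrans C C (endo_tens F endo_unit) F (fun a => idm (F a)) _ _ _)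
    => /=.
  + abstract (by move=> *; rewrite comp1m compm1).
  + abstract (by move=> *; rewrite tensm1 comp1m).
  + abstract (by rewrite compm1 comp1m).
- refine (@MonTrans C C F (endo_tens F endo_unit) (fun a => idm (F a)) _ _ _)
    => /=.
  + abstract (by move=> *; rewrite comp1m compm1).
  + abstract (by move=> *; rewrite tensm1 comp1m !compm1).
  + abstract (by rewrite compm1 comp1m).
- abstract (by apply: mon_trans_ext => a /=; rewrite comp1m).
- abstract (by apply: mon_trans_ext => a /=; rewrite comp1m).
Defined.

Definition endo_data : monoidal_data.
Proof.
refine (@MonoidalData endo_category endo_unit endo_tens endo_tensm _ _
  endo_assoc endo_lunit endo_runit).
- abstract (by move=> F G; apply: mon_trans_ext => a /=; rewrite fmap1 comp1m).
- abstract (by move=> F F' F'' G G' G'' s' s t' t; apply: mon_trans_ext => a /=;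
    rewrite fmapM -!compA; f_equal; rewrite !compA mt_nat).
Defined.

Lemma endo_axioms : monoidal_axioms endo_data.
Proof.
split.
- move=> F F' G G' H H' s t u; apply: mon_trans_ext => a /=.
  by rewrite compm1 comp1m fmapM compA.
- by move=> F F' s; apply: mon_trans_ext => a /=; rewrite fmap1 comp1m !compm1.
- by move=> F F' s; apply: mon_trans_ext => a /=; rewrite !comp1m compm1.
- move=> F G H K; apply: mon_trans_ext => a /=.
  by rewrite !fmap1 !comp1m.
- by move=> F G; apply: mon_trans_ext => a /=; rewrite !fmap1 !comp1m.
Qed.

Definition endo : monoidal_category := MonoidalCategory endo_axioms.

Definition iso_component F G (i : @iso endo F G) (a : C) : iso (F a) (G a).
Proof.
refine (@Iso C (F a) (G a) ((iso_hom i : mon_trans F G) a)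
  ((iso_inv i : mon_trans G F) a) _ _).
- abstract (exact: (f_equal (fun s : mon_trans F F => s a) (isoK i))).
- abstract (exact: (f_equal (fun s : mon_trans G G => s a) (isoVK i))).
Defined.

End Endo.

Definition strong_action (X C : monoidal_category) : Type :=
  strong_functor X (endo C).

Section Semidirect.
Variables (X C : monoidal_category) (Γ : strong_action X C).

Definition act (x : X) : strong_functor C C := Γ x.

Definition actm (x y : X) (f : hom x y) : mon_trans (act x) (act y) :=
  fmap Γ f.

(** The oplax structure maps [C^(X ⊗ Y) -> (C^X)^Y] and [C^I -> C] are the
    inverses of those recorded in [strong_functor]. *)
Definition psi (x y : X) (c : C) : iso (act (x ⊗ y) c) (act y (act x c)) :=
  iso_component (iso_sym (phi Γ x y)) c.

Definition psi0 (c : C) : iso (act unit c) c :=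
  iso_component (iso_sym (phi0 Γ)) c.

Definition sd_category : category := prod_category X C.

Definition sd_tens (p q : sd_category) : sd_category :=
  (fst p ⊗ fst q, act (fst q) (snd p) ⊗ snd q).

(** The bifunctor [(B, Y) |-> B^Y] on a pair of morphisms [(g, h)] is [g^Y]
    followed by a component of [(-)^h]. *)
Definition sd_tensm (p p' q q' : sd_category) (f : hom p p') (g : hom q q') :
  hom (sd_tens p q) (sd_tens p' q') :=
  (fst f ⊗m fst g,
   (actm (fst g) (snd p') ∘ fmap (act (fst q)) (snd f)) ⊗m snd g).

Definition sd_assoc (p q r : sd_category) :
  iso (sd_tens p (sd_tens q r)) (sd_tens (sd_tens p q) r) :=
  @iso_pair X C (sd_tens p (sd_tens q r)) (sd_tens (sd_tens p q) r)
    (assoc (fst p) (fst q) (fst r))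
    (iso_comp
       (iso_comp
          (iso_tens (phi (act (fst r)) (act (fst q) (snd p)) (snd q))
                    (iso_id (snd r)))
          (assoc (act (fst r) (act (fst q) (snd p))) (act (fst r) (snd q))
                 (snd r)))
       (iso_tens (psi (fst q) (fst r) (snd p))
                 (iso_id (act (fst r) (snd q) ⊗ snd r)))).

Definition sd_unit : sd_category := (unit, unit).

Definition sd_lunit (p : sd_category) : iso p (sd_tens sd_unit p) :=
  @iso_pair X C p (sd_tens sd_unit p)
    (lunit (fst p))
    (iso_comp (iso_tens (phi0 (act (fst p))) (iso_id (snd p)))
              (lunit (snd p))).

Definition sd_runit (p : sd_category) : iso (sd_tens p sd_unit) p :=
  @iso_pair X C (sd_tens p sd_unit) p
    (runit (fst p))
    (iso_comp (runit (snd p)) (iso_tens (psi0 (snd p)) (iso_id unit))).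

Lemma sd_tensm1 (p q : sd_category) :
  sd_tensm (idm p) (idm q) = idm (sd_tens p q).
Proof. by rewrite /sd_tensm /actm /= fmap1 tensm1 fmap1 /= comp1m tensm1. Qed.

Lemma sd_tensmM (p p' p'' q q' q'' : sd_category)
  (f' : hom p' p'') (f : hom p p') (g' : hom q' q'') (g : hom q q') :
  sd_tensm (f' ∘ f) (g' ∘ g) = sd_tensm f' g' ∘ sd_tensm f g.
Proof.
rewrite /sd_tensm /actm /= fmapM tensmM -(tensmM _ _ (snd g')) /=.
do 2 f_equal; rewrite fmapM -!compA; f_equal.
by rewrite !compA mt_nat.
Qed.

Definition semidirect : monoidal_data :=
  @MonoidalData sd_category sd_unit sd_tens sd_tensm sd_tensm1 sd_tensmM
    sd_assoc sd_lunit sd_runit.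

End Semidirect.

(* Main.v *)
(** With [X'] and [C'] left duals of [X] and [C], a left dual of [⟨X, C⟩] is
    [⟨X', C'^X'⟩].  A strong monoidal functor preserves left duals.  For the
    action this makes [(-)^X'] a left dual of [(-)^X] in the category of
    endofunctors: there are monoidal transformations [(D^X')^X -> D] and
    [D -> (D^X)^X'] satisfying the triangle identities.  The evaluation
    [(C'^X')^X ⊗ C -> C' ⊗ C -> I] uses the first of them, and the coevaluation
    [I -> C^X' ⊗ C'^X'] is the image under [(-)^X'] of the one of [C].  The
    first triangle identity then reduces to that of [C] because [(D^X')^X -> D]
    is monoidal and natural, and the second one to that of [C'^X'] as the left
    dual of [C^X']. *)

From Stdlib Require Import ssreflect.
Require Import Defs.

Set Implicit Arguments.
Unset Strict Implicit.
Unset Printing Implicit Defensive.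

(** * Cancellation of isomorphisms *)

Section Isomorphisms.
Variable C : category.

Lemma iso_cancel_l (a b d : C) (i : iso a b) (f : hom d a) :
  iso_inv i ∘ (i ∘ f) = f.
Proof. by rewrite compA isoK comp1m. Qed.

Lemma iso_cancel_Vl (a b d : C) (i : iso a b) (f : hom d b) :
  i ∘ (iso_inv i ∘ f) = f.
Proof. by rewrite compA isoVK comp1m. Qed.

Lemma iso_mono (a b d : C) (i : iso a b) (f g : hom d a) :
  i ∘ f = i ∘ g -> f = g.
Proof. by move=> e; rewrite -(iso_cancel_l i f) e iso_cancel_l. Qed.

Lemma iso_epi (a b d : C) (i : iso a b) (f g : hom b d) :
  f ∘ i = g ∘ i -> f = g.
Proof.
by move=> e; rewrite -(compm1 f) -(isoVK i) compA e -compA isoVK compm1.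
Qed.

(** Passes naturality on to inverse structure maps: the oplax [psi] and the inverse associator. *)
Lemma iso_square (a b a' b' : C) (i : iso a b) (j : iso a' b')
  (f : hom a a') (g : hom b b') :
  g ∘ i = j ∘ f -> iso_inv j ∘ g = f ∘ iso_inv i.
Proof.
by move=> e; apply: (iso_epi (i := i)); rewrite -!compA e isoK compm1 iso_cancel_l.
Qed.

End Isomorphisms.

(** * Strong monoidal functors preserve left duals *)

Section PreserveDuals.
Variables (M N : monoidal_category) (F : strong_functor M N).
Variables (a : M) (d : left_dual a).

Local Notation a' := (dual_ob d).

Definition strong_ev : hom (F a' ⊗ F a) unit :=
  iso_inv (phi0 F) ∘ fmap F (ev d) ∘ phi F a' a.

Definition strong_coev : hom unit (F a ⊗ F a') :=
  iso_inv (phi F a a') ∘ fmap F (coev d) ∘ phi0 F.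

Lemma strong_zigzag_dual :
  iso_inv (lunit (F a')) ∘ (strong_ev ⊗m idm (F a'))
    ∘ assoc (F a') (F a) (F a') ∘ (idm (F a') ⊗m strong_coev)
    ∘ iso_inv (runit (F a')) = idm (F a').
Proof.
(* The second triangle identity of [d], freed of inverses and mapped by [F]. *)
have e : fmap F (ev d ⊗m idm a') ∘ (fmap F (assoc a' a a')
    ∘ fmap F (idm a' ⊗m coev d)) = fmap F (lunit a') ∘ fmap F (runit a').
  rewrite -!fmapM; f_equal.
  apply: (iso_mono (i := iso_sym (lunit a'))).
  apply: (iso_epi (i := iso_sym (runit a'))) => /=.
  by rewrite (compA _ (lunit a')) isoK comp1m isoVK !compA zigzag_dual.
apply: (iso_mono (i := lunit (F a'))); apply: (iso_epi (i := runit (F a'))).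
rewrite -!compA iso_cancel_Vl isoK compm1 comp1m.
(* Composing with this isomorphism lets [phi_lunit] turn the unit map of [F a'] into the image of
   that of [a']. *)
apply: (iso_mono
  (i := iso_comp (phi F unit a') (iso_tens (phi0 F) (iso_id _)))) => /=.
rewrite [RHS]compA -phi_lunit -phi_runit.
rewrite !(compA (fmap F (lunit a'))) -e -!compA (comp_cut (phi_natr F _ _)).
rewrite /strong_ev /strong_coev !tensm_compr !tensm_compl -!compA.
rewrite (compA (phi0 F ⊗m _)) -tensm_compl isoVK tensm1 comp1m.
rewrite -(comp_cut (phi_natl F _ _)); f_equal.
rewrite !compA; do 2 f_equal.
by rewrite -phi_assoc -!compA -tensm_compr isoVK tensm1 compm1.
Qed.

End PreserveDuals.

(** ** The structure maps of the action *)

Section ActionComponents.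
Variables (X C : monoidal_category) (Γ : strong_action X C).

Lemma psi_nat (x y : X) (c c' : C) (f : hom c c') :
  psi Γ x y c' ∘ fmap (act Γ (x ⊗ y)) f
  = fmap (act Γ y) (fmap (act Γ x) f) ∘ psi Γ x y c.
Proof. exact: (mt_nat (iso_inv (phi Γ x y)) f). Qed.

Lemma psi0_nat (c c' : C) (f : hom c c') :
  psi0 Γ c' ∘ fmap (act Γ unit) f = f ∘ psi0 Γ c.
Proof. exact: (mt_nat (iso_inv (phi0 Γ)) f). Qed.

Lemma psi_actm (x x' y y' : X) (f : hom x x') (g : hom y y') (c : C) :
  psi Γ x' y' c ∘ actm Γ (f ⊗m g) c
  = actm Γ g (act Γ x' c) ∘ fmap (act Γ y) (actm Γ f c) ∘ psi Γ x y c.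
Proof.
have e := iso_square (phi_nat Γ f g).
exact: (f_equal (fun t : mon_trans _ _ => t c) e).
Qed.

Lemma psi_phi (x y : X) (c d : C) :
  psi Γ x y (c ⊗ d) ∘ phi (act Γ (x ⊗ y)) c d
  = fmap (act Γ y) (phi (act Γ x) c d) ∘ phi (act Γ y) (act Γ x c) (act Γ x d)
    ∘ (psi Γ x y c ⊗m psi Γ x y d).
Proof. exact: (mt_phi (iso_inv (phi Γ x y)) c d). Qed.

(** The component at [c] of the associativity law of [Γ], inverted; the associator of [endo C] has
    identity components. *)
Lemma psi_assoc (x y z : X) (c : C) :
  fmap (act Γ z) (psi Γ x y c) ∘ psi Γ (x ⊗ y) z c ∘ actm Γ (assoc x y z) c
  = psi Γ y z (act Γ x c) ∘ psi Γ x (y ⊗ z) c.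
Proof.
have e : actm Γ (assoc x y z) c ∘ iso_inv (psi Γ x (y ⊗ z) c)
      ∘ iso_inv (psi Γ y z (act Γ x c))
    = iso_inv (psi Γ (x ⊗ y) z c) ∘ fmap (act Γ z) (iso_inv (psi Γ x y c)).
  have := f_equal (fun t : mon_trans _ _ => t c) (phi_assoc Γ x y z).
  by rewrite /= !fmap1 !compm1 comp1m.
apply: (iso_epi (i := iso_sym (psi Γ x (y ⊗ z) c))).
apply: (iso_epi (i := iso_sym (psi Γ y z (act Γ x c)))).
rewrite -!compA iso_cancel_Vl isoVK [iso_hom (iso_sym _)]/= (compA (actm _ _ _)) e.
by rewrite iso_cancel_Vl -fmapM isoVK fmap1.
Qed.

Lemma psi_lunit (x : X) (c : C) :
  fmap (act Γ x) (psi0 Γ c) ∘ psi Γ unit x c ∘ actm Γ (lunit x) c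
  = idm (act Γ x c).
Proof.
have -> : actm Γ (lunit x) c
    = iso_inv (psi Γ unit x c) ∘ fmap (act Γ x) (iso_inv (psi0 Γ c)).
  have := f_equal (fun t : mon_trans _ _ => t c) (phi_lunit Γ x).
  by rewrite /= comp1m compm1.
by rewrite -compA iso_cancel_Vl -fmapM isoVK fmap1.
Qed.

End ActionComponents.

(** ** The semidirect product is monoidal *)

Lemma mt_phi_nat (M N : monoidal_category) (F G : strong_functor M N)
  (t : mon_trans F G) (a a' b b' : M) (f : hom a a') (g : hom b b') :
  t (a' ⊗ b') ∘ fmap F (f ⊗m g) ∘ phi F a b
  = phi G a' b' ∘ ((t a' ∘ fmap F f) ⊗m (t b' ∘ fmap F g)).
Proof. by rewrite -compA phi_nat compA mt_phi -compA -tensmM. Qed.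

(** * Coherence laws tensored with identities *)

Section Whiskering.
Variable M : monoidal_category.

Lemma assoc_natl (a a' b c : M) (f : hom a a') :
  ((f ⊗m idm b) ⊗m idm c) ∘ assoc a b c = assoc a' b c ∘ (f ⊗m idm (b ⊗ c)).
Proof. by rewrite (assoc_nat (maxioms M)) tensm1. Qed.

Lemma pentagon_cut (a b c d e : M) (f : hom e (a ⊗ (b ⊗ (c ⊗ d)))) :
  (assoc a b c ⊗m idm d) ∘ (assoc a (b ⊗ c) d ∘ ((idm a ⊗m assoc b c d) ∘ f))
  = assoc (a ⊗ b) c d ∘ (assoc a b (c ⊗ d) ∘ f).
Proof. by rewrite !compA (pentagon (maxioms M)). Qed.

Variables (N : monoidal_category) (F : strong_functor M N).

Lemma phi_natl_tens (a a' b : M) (d : N) (f : hom a a') :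
  (fmap F (f ⊗m idm b) ⊗m idm d) ∘ (phi F a b ⊗m idm d)
  = (phi F a' b ⊗m idm d) ∘ ((fmap F f ⊗m idm (F b)) ⊗m idm d).
Proof. by rewrite -!tensm_compl phi_natl. Qed.

Lemma phi_assoc_tens_cut (a b c : M) (d e : N)
  (f : hom e ((F a ⊗ (F b ⊗ F c)) ⊗ d)) :
  (fmap F (assoc a b c) ⊗m idm d)
    ∘ ((phi F a (b ⊗ c) ⊗m idm d) ∘ (((idm (F a) ⊗m phi F b c) ⊗m idm d) ∘ f))
  = (phi F (a ⊗ b) c ⊗m idm d)
    ∘ (((phi F a b ⊗m idm (F c)) ⊗m idm d)
       ∘ ((assoc (F a) (F b) (F c) ⊗m idm d) ∘ f)).
Proof. by rewrite !compA -!tensm_compl phi_assoc. Qed.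

End Whiskering.

Section SemidirectAxioms.
Variables (X C : monoidal_category) (Γ : strong_action X C).

Lemma actm1 (x : X) (c : C) : actm Γ (idm x) c = idm (act Γ x c).
Proof. by rewrite /actm fmap1. Qed.

Local Opaque psi psi0 actm.

Lemma psi_actm_nat (y y' z z' : X) (g : hom y y') (h : hom z z') (a a' : C)
  (f : hom a a') :
  psi Γ y' z' a' ∘ (actm Γ (g ⊗m h) a' ∘ fmap (act Γ (y ⊗ z)) f)
  = actm Γ h (act Γ y' a')
    ∘ fmap (act Γ z) (actm Γ g a' ∘ fmap (act Γ y) f) ∘ psi Γ y z a.
Proof. by rewrite compA psi_actm -compA psi_nat fmapM !compA. Qed.

Lemma sd_assoc_nat (p p' q q' r r' : semidirect Γ)
  (f : hom p p') (g : hom q q') (h : hom r r') :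
  ((f ⊗m g) ⊗m h) ∘ assoc p q r = assoc p' q' r' ∘ (f ⊗m (g ⊗m h)).
Proof.
case: p p' q q' r r' f g h
  => [x a] [x' a'] [y b] [y' b'] [z c] [z' c'] /= [f f'] [g g'] [h h'].
rewrite /= /sd_tensm /= (assoc_nat (maxioms X)); f_equal.
rewrite !compA -tensmM compm1 mt_phi_nat -!compA.
rewrite -[in RHS]tensmM psi_actm_nat comp1m.
(* Splitting [h'] as [idm ∘ h'] separates [phi] from the morphisms. *)
rewrite -{1}(comp1m h') tensmM -compA; f_equal.
rewrite (comp_cut (assoc_nat (maxioms C) _ _ _)); f_equal.
by rewrite -tensmM compm1.
Qed.

Lemma sd_lunit_nat (p p' : semidirect Γ) (f : hom p p') :
  (idm unit ⊗m f) ∘ lunit p = lunit p' ∘ f.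
Proof.
case: p p' f => [x a] [x' a'] /= [f f'].
rewrite /= /sd_tensm /= (lunit_nat (maxioms X)); f_equal.
rewrite fmap1 compm1 compA -tensmM mt_phi0 compm1 -compA.
by rewrite -(lunit_nat (maxioms C)) compA -tensmM comp1m compm1.
Qed.

Lemma sd_runit_nat (p p' : semidirect Γ) (f : hom p p') :
  f ∘ runit p = runit p' ∘ (f ⊗m idm unit).
Proof.
case: p p' f => [x a] [x' a'] /= [f f'].
rewrite /= /sd_tensm /= (runit_nat (maxioms X)); f_equal.
rewrite compA (runit_nat (maxioms C)) -!compA -!tensmM !comp1m actm1 comp1m.
by rewrite psi0_nat.
Qed.

(** In [C], the maps [psi0], [psi] and [actm (lunit _)] cancel by [psi_lunit]; [phi_runit] then
    leaves the triangle of [C]. *)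
Lemma sd_triangle (p q : semidirect Γ) :
  (runit p ⊗m idm q) ∘ assoc p unit q ∘ (idm p ⊗m lunit q) = idm (p ⊗ q).
Proof.
case: p q => [x a] [y b].
rewrite /= /sd_tensm /= (triangle (maxioms X)); f_equal.
rewrite actm1 comp1m fmap1 compm1 fmapM !tensm_compl -!compA.
rewrite (comp_cut (phi_natl_tens _ _ _ _)) (comp_cut (assoc_natl _ _ _)).
rewrite -!tensmM !comp1m (compA (fmap _ _)) psi_lunit.
rewrite tensm_compr -(comp_cut (assoc_nat (maxioms C) _ _ _)).
rewrite !compA -!tensm_compl phi_runit.
exact: triangle (maxioms C) _ _.
Qed.

(** In [C], the pentagon combines four facts: [psi] is coherent ([psi_assoc]) and monoidal
    ([psi_phi]), [act Γ w] respects associators, and [C] satisfies the pentagon. *)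
Lemma sd_pentagon (p q r s : semidirect Γ) :
  (assoc p q r ⊗m idm s) ∘ assoc p (q ⊗ r) s ∘ (idm p ⊗m assoc q r s)
  = assoc (p ⊗ q) r s ∘ assoc p q (r ⊗ s).
Proof.
case: p q r s => [x a] [y b] [z c] [w d].
rewrite /= /sd_tensm /= (pentagon (maxioms X)); f_equal.
rewrite actm1 comp1m fmap1 compm1 !fmapM !tensm_compl -!compA.
rewrite (comp_cut (phi_natl_tens _ _ _ _)) (comp_cut (assoc_natl _ _ _)).
rewrite -!tensmM !comp1m (compA (fmap _ (psi _ _ _ _))) psi_assoc.
set T := psi _ _ _ _ ∘ _.
(* Pulling [phi] and the associator out of the right factor exposes the left-hand sides of
   [phi_assoc] and of the pentagon. *)
have -> : T ⊗m ((phi (act Γ w) (act Γ z b) c ⊗m idm d)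
      ∘ (assoc _ _ _ ∘ (psi Γ z w b ⊗m idm (act Γ w c ⊗ d))))
    = (idm _ ⊗m (phi (act Γ w) (act Γ z b) c ⊗m idm d))
      ∘ ((idm _ ⊗m assoc _ _ _) ∘ (T ⊗m (psi Γ z w b ⊗m idm (act Γ w c ⊗ d))))
  by rewrite -!tensmM !comp1m.
rewrite -(comp_cut (assoc_nat (maxioms C) _ _ _)) phi_assoc_tens_cut pentagon_cut.
rewrite (comp_cut (phi_natl_tens _ _ _ _)); f_equal.
rewrite (compA (psi _ _ _ _ ⊗m _)) -tensm_compl psi_phi !tensm_compl -!compA.
rewrite (comp_cut (assoc_nat (maxioms C) (psi Γ z w _) (psi Γ z w _) _)).
by rewrite -!(comp_cut (assoc_natl _ _ _)) -tensmM compm1.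
Qed.

Lemma sd_axioms : monoidal_axioms (semidirect Γ).
Proof.
exact: MonoidalAxioms sd_assoc_nat sd_lunit_nat sd_runit_nat sd_pentagon
  sd_triangle.
Qed.

End SemidirectAxioms.

(** ** Left duals in the semidirect product *)

Section SemidirectDuals.
Variables (X C : monoidal_category) (Γ : strong_action X C).
Variables (x : X) (c : C) (dx : left_dual x) (dc : left_dual c).

Local Notation x' := (dual_ob dx).
Local Notation c' := (dual_ob dc).

(** [locked] keeps [rewrite compA] from unfolding the transformations into the
    composites that define them. *)
Definition act_ev (a : C) : hom (act Γ x (act Γ x' a)) a :=
  locked ((strong_ev Γ dx : mon_trans (endo_tens _ _) (endo_unit C)) a).

Definition act_coev (a : C) : hom a (act Γ x' (act Γ x a)) :=
  locked ((strong_coev Γ dx : mon_trans (endo_unit C) (endo_tens _ _)) a).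

Lemma act_evE (a : C) :
  act_ev a = psi0 Γ a ∘ actm Γ (ev dx) a ∘ iso_inv (psi Γ x' x a).
Proof. by rewrite /act_ev -lock. Qed.

Lemma act_coevE (a : C) :
  act_coev a = psi Γ x x' a ∘ actm Γ (coev dx) a ∘ iso_inv (psi0 Γ a).
Proof. by rewrite /act_coev -lock. Qed.

Lemma act_ev_nat (a b : C) (f : hom a b) :
  act_ev b ∘ fmap (act Γ x) (fmap (act Γ x') f) = f ∘ act_ev a.
Proof. rewrite /act_ev -!lock; exact: (mt_nat (strong_ev Γ dx) f). Qed.

Lemma act_ev_phi (a b : C) :
  act_ev (a ⊗ b) ∘ (fmap (act Γ x) (phi (act Γ x') a b)
    ∘ phi (act Γ x) (act Γ x' a) (act Γ x' b)) = act_ev a ⊗m act_ev b.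
Proof.
(* The added identity is the [phi] of the identity functor. *)
by rewrite /act_ev -!lock -[RHS]comp1m; exact: (mt_phi (strong_ev Γ dx) a b).
Qed.

Lemma act_ev_phi0 :
  act_ev unit ∘ (fmap (act Γ x) (phi0 (act Γ x')) ∘ phi0 (act Γ x)) = idm unit.
Proof. rewrite /act_ev -!lock; exact: (mt_phi0 (strong_ev Γ dx)). Qed.

(** The component at [a] of the triangle identity for the dual of [act Γ x] in [endo C], whose
    structure maps have identity components. *)
Lemma act_zigzag (a : C) :
  fmap (act Γ x') (act_ev a) ∘ act_coev (act Γ x' a) = idm (act Γ x' a).
Proof.
have := f_equal (fun t : mon_trans _ _ => t a) (strong_zigzag_dual Γ dx).
by rewrite /= !comp1m !compm1 /act_ev /act_coev -!lock.
Qed.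

Local Opaque psi psi0 actm.

Definition sd_dual_ob : semidirect Γ := (x', act Γ x' c').

Definition sd_ev : hom (sd_dual_ob ⊗ ((x, c) : semidirect Γ)) unit :=
  (ev dx, ev dc ∘ (act_ev c' ⊗m idm c)).

Definition sd_coev : hom unit (((x, c) : semidirect Γ) ⊗ sd_dual_ob) :=
  (coev dx, strong_coev (act Γ x') dc).

(** Monoidality of [act_ev] absorbs the maps [phi], and naturality then moves it past [coev dc]. *)
Lemma act_ev_strong_coev :
  (act_ev c ⊗m act_ev c') ∘ iso_inv (phi (act Γ x) (act Γ x' c) (act Γ x' c'))
    ∘ fmap (act Γ x) (strong_coev (act Γ x') dc) ∘ phi0 (act Γ x) = coev dc.
Proof.
rewrite -act_ev_phi /strong_coev !fmapM -!compA iso_cancel_Vl.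
rewrite (compA (fmap _ (phi _ _ _))) -fmapM isoVK fmap1 comp1m.
by rewrite (comp_cut (act_ev_nat _)) act_ev_phi0 compm1.
Qed.

Lemma sd_zigzag :
  runit ((x, c) : semidirect Γ) ∘ (idm ((x, c) : semidirect Γ) ⊗m sd_ev)
    ∘ iso_inv (assoc ((x, c) : semidirect Γ) sd_dual_ob (x, c))
    ∘ (sd_coev ⊗m idm ((x, c) : semidirect Γ)) ∘ lunit ((x, c) : semidirect Γ)
  = idm ((x, c) : semidirect Γ).
Proof.
rewrite /= /sd_tensm /=; f_equal; first exact: zigzag.
rewrite actm1 comp1m fmap1 compm1.
(* The left factors, coming from [runit], [sd_ev] and the inverse associator, compose to
   [act_ev c]. *)
have front : (psi0 Γ c ⊗m idm unit)
      ∘ ((actm Γ (ev dx) c ⊗m (ev dc ∘ (act_ev c' ⊗m idm c)))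
         ∘ (iso_inv (psi Γ x' x c) ⊗m idm _))
    = (idm c ⊗m ev dc) ∘ (act_ev c ⊗m (act_ev c' ⊗m idm c)).
  by rewrite -!tensmM !comp1m compm1 (act_evE c) compA.
rewrite -!compA (compA (actm _ _ _ ⊗m _)) (compA (psi0 _ _ ⊗m _)) front.
rewrite -!compA -(comp_cut (iso_square (assoc_nat (maxioms C) _ _ _))).
(* What remains is the first triangle identity of [dc], with [coev dc] expanded. *)
by rewrite -[RHS](zigzag dc) -act_ev_strong_coev !tensm_compl -!compA.
Qed.

Lemma sd_zigzag_dual :
  iso_inv (lunit sd_dual_ob) ∘ (sd_ev ⊗m idm sd_dual_ob)
    ∘ assoc sd_dual_ob (x, c) sd_dual_ob ∘ (idm sd_dual_ob ⊗m sd_coev)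
    ∘ iso_inv (runit sd_dual_ob) = idm sd_dual_ob.
Proof.
rewrite /= /sd_tensm /=; f_equal; first exact: zigzag_dual.
rewrite actm1 comp1m fmap1 compm1.
(* Dually, the maps from the associator, [sd_coev] and the inverse of [runit] compose to
   [act_coev]. *)
have back : (psi Γ x x' (act Γ x' c') ⊗m idm (act Γ x' c ⊗ act Γ x' c'))
      ∘ ((actm Γ (coev dx) (act Γ x' c') ⊗m strong_coev (act Γ x') dc)
         ∘ (iso_inv (psi0 Γ (act Γ x' c')) ⊗m idm unit))
    = act_coev (act Γ x' c') ⊗m strong_coev (act Γ x') dc.
  by rewrite -!tensmM comp1m compm1 act_coevE compA.
rewrite -!compA (compA (actm _ _ _ ⊗m _)) (compA (psi _ _ _ _ ⊗m _)) back.
(* The image of [act_ev c'] is moved past [phi] and the associator to meet [act_coev], which it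
   cancels by [act_zigzag]. *)
rewrite fmapM tensm_compl -!compA (comp_cut (phi_natl_tens _ _ _ _)).
rewrite (comp_cut (assoc_natl _ _ _)) (compA _ (act_coev _ ⊗m _)) -tensmM.
rewrite act_zigzag comp1m.
rewrite -[RHS](strong_zigzag_dual (act Γ x') dc).
by rewrite /strong_ev !tensm_compl -!compA.
Qed.

Definition sd_left_dual : left_dual ((x, c) : semidirect Γ) :=
  LeftDual sd_zigzag sd_zigzag_dual.

End SemidirectDuals.

Theorem theorem6p2 (X C : monoidal_category)
  (hX : left_autonomous X) (hC : left_autonomous C)
  (Γ : strong_action X C) :
  monoidal_axioms (semidirect Γ) /\ left_autonomous (semidirect Γ).
Proof.
split; first exact: sd_axioms.
case=> x c; case: (hX x) => dx; case: (hC c) => dc.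
exact: (inhabits (sd_left_dual Γ dx dc)).
Qed.
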